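(* Let $A$ be a finite non-empty alphabet, let $k$ be a positive integer and let $w=w_1w_2\cdots\in A^{\mathbb N}$ be an infinite word. If $w$ is $k$-power-free, then for each positive integer $P$ there exists a prefix $u$ of $w$ with $|u|_{\rm pal}>P$.
   Context: $A^+$ is the set of finite non-empty words over $A$. A $k$-power is a word of the form $u^k$ with $u\in A^+$. An infinite word is $k$-power-free if none of its (finite) factors is a $k$-power. A palindrome is a finite word equal to its reversal; the empty word and all letters are palindromes. The palindromic length $|u|_{\rm pal}$ of $u\in A^+$ is the least $n$ such that $u=v_1v_2\cdots v_n$ with each $v_i$ a palindrome. *)

(* Defs.v *)
From mathcomp Require Import all_boot.

Set Implicit Arguments.
Unset Strict Implicit.
Unset Printing Implicit Defensive.

(* Finite words are [seq A]; infinite words are functions [nat -> A], indexed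
   from 0, so that [w 0] is the first letter. *)

Definition is_prefix (A : Type) (w : nat -> A) (u : seq A) : Prop :=
  exists n, u = mkseq w n.

Definition is_factor (A : Type) (w : nat -> A) (u : seq A) : Prop :=
  exists i n, u = mkseq (fun j => w (i + j)) n.

Definition is_power (A : Type) (k : nat) (v : seq A) : Prop :=
  exists u : seq A, u <> [::] /\ v = flatten (nseq k u).

Definition power_free (A : Type) (k : nat) (w : nat -> A) : Prop :=
  forall v, is_factor w v -> ~ is_power k v.

Definition palindrome (A : eqType) (u : seq A) : bool := rev u == u.

Section PalindromicLength.
Variable A : finType.
Implicit Types u : seq A.

(* The blocks are taken among the words of length at most [size u] only to make
   the existential decidable; [pal_factorizableP] removes the bound. *)
Definition pal_factorizable u (n : nat) : bool :=
  [exists vs : n.-tuple ((size u).-bseq A),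
     let s := [seq val v | v <- vs] in
     all (@palindrome A) s && (flatten s == u)].

Lemma pal_factorizableP u n :
  reflect (exists vs : seq (seq A),
             [/\ size vs = n, all (@palindrome A) vs & u = flatten vs])
          (pal_factorizable u n).
Proof.
apply: (iffP existsP) => [[vs /= /andP[pal_vs /eqP def_u]]|].
  by exists [seq val v | v <- vs]; rewrite size_map size_tuple.
case=> vs [sz_vs pal_vs def_u].
have le_vs v : v \in vs -> size v <= size u.
  rewrite def_u => /splitPr[s1 s2].
  by rewrite flatten_cat /= !size_cat addnCA leq_addr.
pose f v : (size u).-bseq A := insub_bseq (size u) v.
have sz_f : size (map f vs) == n by rewrite size_map sz_vs.
exists (Tuple sz_f) => /=.
have -> : [seq val v | v <- map f vs] = vs.
  rewrite -map_comp map_id_in // => v /le_vs le_v.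
  by rewrite /f /= /insub_bseq val_insubd le_v.
by rewrite pal_vs def_u eqxx.
Qed.

Lemma pal_factorizable_ex u : exists n, pal_factorizable u n.
Proof.
exists (size u); apply/pal_factorizableP; exists [seq [:: a] | a <- u].
split; first by rewrite size_map.
- by rewrite all_map; apply/allP => a _; rewrite /= /palindrome.
- by elim: u => //= a u {1}->.
Qed.

(* Also defined on the empty word, where it is 0. *)
Definition pal_length u : nat := ex_minn (pal_factorizable_ex u).

End PalindromicLength.

(* Main.v *)
Require Import Defs.
From mathcomp Require Import all_boot zify.

(** Two palindromes that are prefixes of the same word force a period: if their
    lengths are m < m', then the longer one has period m' - m.  A k-power-free
    word therefore satisfies m' < k * (m' - m) (lemma [palindrome_gap]), so the
    lengths of the palindromes that begin at a given position grow
    geometrically, and only O(n) of them are below 2 ^ n.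

    Now suppose that every prefix of w is a product of P palindromes.  A prefix
    is determined by the list of the lengths of its P blocks, and once the
    beginning of a block is known, its length is one of O(n) possible values.
    Hence only O(n) ^ P prefixes are shorter than 2 ^ n, whereas there are 2 ^ n
    of them; this is absurd when n is large.

    The count takes the form of an injection.  Every length m < 2 ^ n has a code
    in a set of O(n) elements ([length_code]); two palindromes beginning at the
    same position and having the same code are equal ([length_code_inj]), so the
    codes of the blocks, read from left to right, determine the prefix
    ([cuts_inj]). *)

Set Implicit Arguments.
Unset Strict Implicit.
Unset Printing Implicit Defensive.

Definition factor_at (A : Type) (w : nat -> A) (i n : nat) : seq A :=
  mkseq (fun j => w (i + j)) n.

(** * Periods and palindromes *)

Lemma mkseq_add (T : Type) (f : nat -> T) (m n : nat) :
  mkseq f (m + n) = mkseq f m ++ mkseq (fun j => f (m + j)) n.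
Proof.
by rewrite /mkseq iotaD map_cat add0n -[m in iota m n]addn0 iotaDl -map_comp.
Qed.

Lemma eq_mkseq_lt (T : Type) (f g : nat -> T) (n : nat) :
  (forall j, j < n -> f j = g j) -> mkseq f n = mkseq g n.
Proof.
elim: n => [//|n IHn] fg; rewrite !mkseqS fg // IHn // => j ltjn.
by apply: fg; apply: ltnW.
Qed.

Lemma periodic_mkseq (T : Type) (f : nat -> T) (p k : nat) :
  (forall j, j + p < k * p -> f (j + p) = f j) ->
  mkseq f (k * p) = flatten (nseq k (mkseq f p)).
Proof.
elim: k => [|k IHk] fp; first by rewrite mul0n.
rewrite mulSn mkseq_add /= -IHk; last first.
  by move=> j ltj; apply: fp; rewrite mulSn; apply: ltn_addl.
congr (_ ++ _); apply: eq_mkseq_lt => j ltj.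
by rewrite addnC fp // mulSn addnC ltn_add2l.
Qed.

Lemma palindrome_mkseq (A : eqType) (f : nat -> A) (n j : nat) :
  palindrome (mkseq f n) -> j < n -> f j = f (n - j.+1).
Proof.
move=> /eqP pal_f ltjn.
rewrite -(nth_mkseq (f 0) f ltjn) -pal_f nth_rev size_mkseq //.
by rewrite nth_mkseq //; lia.
Qed.

(** The reflections about the centres of the two palindromes compose to the
    translation by m' - m, which is therefore a period of the longer one; if
    it went k times into m', the longer one would begin with a k-power. *)
Lemma palindrome_gap (A : eqType) (k : nat) (w : nat -> A) (i m m' : nat) :
  power_free k w -> palindrome (factor_at w i m) ->
  palindrome (factor_at w i m') -> m < m' -> m' < k * (m' - m).
Proof.
move=> free_w pal_m pal_m' ltmm'; rewrite ltnNge; apply/negP => le_kp.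
set p := m' - m in le_kp.
apply: (free_w (factor_at w i (k * p))); first by exists i, (k * p).
exists (factor_at w i p); split.
  by move/(congr1 size); rewrite size_mkseq /p /=; lia.
apply: periodic_mkseq => j ltj.
have ltjm : j < m by rewrite /p in ltj le_kp; lia.
rewrite (palindrome_mkseq (f := fun j => w (i + j)) pal_m ltjm).
rewrite (palindrome_mkseq (f := fun j => w (i + j)) pal_m'); last by lia.
by congr (w (i + _)); rewrite /p; lia.
Qed.

(** * Coding the lengths of the palindromes beginning at a given position *)

(** For m < 2 ^ n, which keeps [inord] away from its default value: the exponent
    e such that 2 ^ e <= m < 2 ^ e.+1 (0 when m = 0), and the rank of m among
    the successive intervals of length 2 ^ e / k.  Two numbers with the same
    code are closer than 2 ^ e / k, which is what [palindrome_gap] forbids.  The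
    rank is at most 2 * k because m < 2 * 2 ^ e. *)
Definition length_code (n k m : nat) : 'I_n.+1 * 'I_(2 * k).+1 :=
  (inord (trunc_log 2 m), inord (m * k %/ 2 ^ trunc_log 2 m)).

Lemma length_code_fst (n k m : nat) :
  m < 2 ^ n -> (length_code n k m).1 = trunc_log 2 m :> nat.
Proof.
move=> ltm; rewrite /= inordK // ltnS.
case: (posnP m) => [->|m_gt0]; first by rewrite trunc_log0.
rewrite -(leq_exp2l (m := 2)) //; apply: leq_trans (ltnW ltm).
exact: trunc_logP.
Qed.

Lemma length_code_snd (n k m : nat) :
  (length_code n k m).2 = m * k %/ 2 ^ trunc_log 2 m :> nat.
Proof.
rewrite /= inordK // ltnS -ltnS ltn_divLR ?expn_gt0 //.
have ltm := @trunc_log_ltn 2 m isT; rewrite expnS in ltm.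
by rewrite mulSn; have := expn_gt0 2 (trunc_log 2 m); nia.
Qed.

(** If m < m' had the same code, k * m and k * m' would have the same quotient
    by 2 ^ e, so k * (m' - m) < 2 ^ e <= m', against [palindrome_gap]. *)
Lemma length_code_inj (A : eqType) (k : nat) (w : nat -> A) (n i m m' : nat) :
  power_free k w -> m < 2 ^ n -> m' < 2 ^ n ->
  palindrome (factor_at w i m) -> palindrome (factor_at w i m') ->
  length_code n k m = length_code n k m' -> m = m'.
Proof.
move=> free_w.
wlog lemm' : m m' / m <= m' => [IH|] ltm ltm' pal_m pal_m' eq_c.
  by case/orP: (leq_total m m') => le_m; [|symmetry]; apply: IH.
have eq_e : trunc_log 2 m = trunc_log 2 m'.
  by rewrite -(length_code_fst k ltm) eq_c length_code_fst.
have := length_code_snd n k m; rewrite eq_c length_code_snd eq_e => eq_q.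
apply/eqP; rewrite eqn_leq lemm' leqNgt; apply/negP => ltmm'.
have gap := palindrome_gap free_w pal_m pal_m' ltmm'.
have le_m' : 2 ^ trunc_log 2 m' <= m'.
  by apply: trunc_logP => //; apply: leq_ltn_trans ltmm'.
move: (2 ^ _) eq_q le_m' (expn_gt0 2 (trunc_log 2 m')) => d eq_q le_d d_gt0.
have := divn_eq (m * k) d; have := divn_eq (m' * k) d; rewrite eq_q.
have := ltn_pmod (m' * k) (d_gt0 : 0 < d).
rewrite mulnBr in gap; lia.
Qed.

(** * Factorizations of prefixes into palindromes *)

Fixpoint palindromic_cuts (A : eqType) (w : nat -> A) (i : nat) (ms : seq nat)
    : bool :=
  if ms is m :: ms' then
    palindrome (factor_at w i m) && palindromic_cuts w (i + m) ms'
  else true.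

Lemma flatten_cuts (A : eqType) (w : nat -> A) (vs : seq (seq A)) (i n : nat) :
  all (@palindrome A) vs -> factor_at w i n = flatten vs ->
  palindromic_cuts w i (shape vs) && (sumn (shape vs) == n).
Proof.
elim: vs i n => [|v vs IHvs] i n /=.
  by move=> _ /(congr1 size); rewrite size_mkseq => ->.
case/andP=> pal_v pal_vs eq_v.
have le_vn : size v <= n.
  rewrite -(size_mkseq (fun j => w (i + j)) n) [mkseq _ _]eq_v size_cat.
  exact: leq_addr.
move: eq_v; rewrite /factor_at -{1}(subnKC le_vn) mkseq_add => /eqP.
rewrite eqseq_cat ?size_mkseq // => /andP[/eqP eq_v /eqP eq_vs].
rewrite /factor_at eq_v pal_v /=.
have /andP[-> /eqP->] : palindromic_cuts w (i + size v) (shape vs)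
    && (sumn (shape vs) == n - size v).
  apply: IHvs pal_vs _; rewrite -eq_vs; apply: eq_mkseq_lt => j _.
  by rewrite addnA.
by rewrite subnKC /=.
Qed.

(** Empty blocks are palindromes, so a factorization can be padded to any
    number of blocks that is not less than the palindromic length. *)
Lemma pal_length_cuts (A : finType) (w : nat -> A) (n P : nat) :
  pal_length (mkseq w n) <= P ->
  exists ms, [/\ size ms = P, palindromic_cuts w 0 ms & sumn ms = n].
Proof.
rewrite /pal_length; case: ex_minnP => q.
move=> /pal_factorizableP[vs [sz_vs pal_vs def_w]] _ leqP.
pose vs' := vs ++ nseq (P - q) [::].
have pal_vs' : all (@palindrome A) vs'.
  by rewrite all_cat pal_vs all_nseq orbT.
have fl_vs' : factor_at w 0 n = flatten vs'.
  rewrite flatten_cat -def_w (_ : flatten (nseq _ _) = [::]) ?cats0 //.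
  by elim: (P - q).
have /andP[cuts /eqP sum_n] := flatten_cuts pal_vs' fl_vs'.
by exists (shape vs'); rewrite size_map size_cat size_nseq sz_vs subnKC.
Qed.

(** The first code determines the first block, hence the position at which the
    remaining blocks begin. *)
Lemma cuts_inj (A : eqType) (k : nat) (w : nat -> A) (n i : nat)
    (ms ms' : seq nat) :
  power_free k w -> sumn ms < 2 ^ n -> sumn ms' < 2 ^ n ->
  palindromic_cuts w i ms -> palindromic_cuts w i ms' ->
  map (length_code n k) ms = map (length_code n k) ms' -> ms = ms'.
Proof.
move=> free_w; elim: ms ms' i => [|m ms IHms] [|m' ms'] i //.
move=> /= lt_ms lt_ms' /andP[pal_m cuts_ms] /andP[pal_m' cuts_ms'] eq_c.
have eq_m : m = m'.
  have eq_hd := congr1 (head (length_code n k m)) eq_c.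
  apply: (length_code_inj free_w _ _ pal_m pal_m' eq_hd).
    exact: leq_ltn_trans (leq_addr _ _) lt_ms.
  exact: leq_ltn_trans (leq_addr _ _) lt_ms'.
subst m'; congr cons; apply: (IHms _ (i + m)) => //.
- exact: leq_ltn_trans (leq_addl _ _) lt_ms.
- exact: leq_ltn_trans (leq_addl _ _) lt_ms'.
exact: (congr1 behead eq_c).
Qed.

(** * The count *)

Lemma poly_lt_exp (c P : nat) : exists n, (n.+1 * c) ^ P < 2 ^ n.
Proof.
(* The choice n.+1 = 2 ^ (2 * t) bounds the left-hand side by a power of 2, whose
   exponent (2 * t + c) * P is at most 3 * t ^ 2, while n.+1 >= (4 * t) ^ 2. *)
pose t := P + c + 4.
have le_t : 4 * t <= 2 ^ t.
  have -> : t = (P + c).+4 by rewrite /t; lia.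
  elim: (P + c) => // x IHx; rewrite expnS; lia.
have def_n : (2 ^ (t + t)).-1.+1 = 2 ^ (t + t) by rewrite prednK ?expn_gt0.
exists (2 ^ (t + t)).-1; rewrite def_n.
apply: (@leq_ltn_trans (2 ^ ((t + t + c) * P))).
  rewrite expnM; have [->|P_gt0] := posnP P; first by rewrite !expn0.
  by rewrite leq_exp2r // [2 ^ (_ + c)]expnD leq_mul2l ltnW ?orbT // ltn_expl.
rewrite ltn_exp2l // -ltnS def_n expnD.
have := leq_mul le_t le_t; rewrite /t; nia.
Qed.

Theorem theorem1 (A : finType) (hA : 0 < #|A|) (k : nat) (hk : 0 < k)
    (w : nat -> A) (hw : power_free k w) (P : nat) (hP : 0 < P) :
  exists u : seq A, is_prefix w u /\ P < pal_length u.
Proof.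
have [n lt_n] := poly_lt_exp (2 * k).+1 P.
have [/existsP[l lt_l]|no_l] :=
  boolP [exists l : 'I_(2 ^ n), P < pal_length (mkseq w l)].
  by exists (mkseq w l); split; first by exists l.
have cuts_of (l : 'I_(2 ^ n)) : exists ms,
    [/\ size ms = P, palindromic_cuts w 0 ms & sumn ms = l].
  apply: pal_length_cuts; rewrite leqNgt.
  by move: no_l; rewrite negb_exists => /forallP.
have [ms ms_cuts] := fin_all_exists cuts_of.
have sz_codes l : size (map (length_code n k) (ms l)) == P.
  by rewrite size_map; case: (ms_cuts l) => ->.
have codes_inj : injective (fun l => Tuple (sz_codes l)).
  move=> l l' /(congr1 val) /= eq_c; apply: val_inj => /=.
  have [_ cuts_l sum_l] := ms_cuts l; have [_ cuts_l' sum_l'] := ms_cuts l'.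
  rewrite -sum_l -sum_l'; congr sumn.
  by apply: (cuts_inj hw _ _ cuts_l cuts_l' eq_c); rewrite ?sum_l ?sum_l'.
have := leq_card _ codes_inj.
by rewrite card_tuple card_prod !card_ord leqNgt lt_n.
Qed.
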